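(* The logic $\mathbf{CL}(\{\top\trianglelefteq p\Rightarrow p,\ p\wedge(p\Rightarrow q)\trianglelefteq q,\ p\trianglelefteq q\Rightarrow p\})$ is sound and complete with respect to the class of selection L-frames $(X,1,\curlywedge,s)$ satisfying $s(x,a)=a\cap{\uparrow}x$ for all $x\in X$ and all filters $a$: a consequence pair belongs to this logic iff it is validated by every such frame.
   Context: Formulas: $\phi::=p\mid\top\mid\bot\mid\phi\wedge\phi\mid\phi\vee\phi\mid\phi\Rightarrow\phi$. $\mathbf{CL}(\Gamma)$ is the smallest set of consequence pairs $\phi\trianglelefteq\psi$ containing $\Gamma$, closed under uniform substitution, containing $p\trianglelefteq\top$, $\bot\trianglelefteq p$, $p\trianglelefteq p$, $p\wedge q\trianglelefteq p$, $p\wedge q\trianglelefteq q$, $p\trianglelefteq p\vee q$, $q\trianglelefteq p\vee q$, $\top\trianglelefteq p\Rightarrow\top$, $p\Rightarrow(q\wedge r)\trianglelefteq(p\Rightarrow q)\wedge(p\Rightarrow r)$, $(p\Rightarrow q)\wedge(p\Rightarrow r)\trianglelefteq p\Rightarrow(q\wedge r)$, closed under transitivity, $\wedge$-introduction (from $r\trianglelefteq p,r\trianglelefteq q$ infer $r\trianglelefteq p\wedge q$), $\vee$-elimination (from $p\trianglelefteq r,q\trianglelefteq r$ infer $p\vee q\trianglelefteq r$), and congruence for $\Rightarrow$ in each argument. A selection L-frame is a meet-semilattice $(X,1,\curlywedge)$ ($x\preccurlyeq y$ iff $x\curlywedge y=x$, ${\uparrow}x=\{y:x\preccurlyeq y\}$)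 with $s:X\times\mathcal F(X)\to\mathcal F(X)$ ($\mathcal F(X)$ the filters: upward closed, closed under finite meets) such that $s(1,a)=\{1\}$; $x\preccurlyeq y$ implies $s(y,a)\subseteq s(x,a)$; if $z\in s(x\curlywedge y,a)$ there are $u\in s(x,a)$, $v\in s(y,a)$ with $u\curlywedge v\preccurlyeq z$. Under a valuation $V$ (letters to filters): $x\Vdash p$ iff $x\in V(p)$; $\top$ always; $x\Vdash\bot$ iff $x=1$; $\wedge$ pointwise; $x\Vdash\phi\vee\psi$ iff some $y\Vdash\phi$, $z\Vdash\psi$ have $y\curlywedge z\preccurlyeq x$; $x\Vdash\phi\Rightarrow\psi$ iff $s(x,[\![\phi]\!])\subseteq[\![\psi]\!]$. A frame validates $\phi\trianglelefteq\psi$ if $[\![\phi]\!]\subseteq[\![\psi]\!]$ for all valuations. *)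

(* Defs.v *)
From HB Require Import structures.
From mathcomp Require Import all_boot all_order.
From mathcomp Require Import boolp classical_sets.

Set Implicit Arguments.
Unset Strict Implicit.
Unset Printing Implicit Defensive.

Import Order.Theory.

Local Open Scope classical_set_scope.

(* Proposition letters are indexed by nat. *)
Inductive formula : Type :=
| Var of nat
| Top
| Bot
| And of formula & formula
| Or of formula & formula
| Imp of formula & formula.

Declare Scope cl_scope.
Delimit Scope cl_scope with cl.
Bind Scope cl_scope with formula.

Notation "⊤" := Top (at level 0) : cl_scope.
Notation "⊥" := Bot (at level 0) : cl_scope.
Notation "p ∧ q" := (And p q) (at level 40, left associativity) : cl_scope.
Notation "p ∨ q" := (Or p q) (at level 50, left associativity) : cl_scope.
Notation "p ⇒ q" := (Imp p q) (at level 55, right associativity) : cl_scope.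

Fixpoint usubst (sigma : nat -> formula) (phi : formula) : formula :=
  match phi with
  | Var n => sigma n
  | Top => Top
  | Bot => Bot
  | And a b => And (usubst sigma a) (usubst sigma b)
  | Or a b => Or (usubst sigma a) (usubst sigma b)
  | Imp a b => Imp (usubst sigma a) (usubst sigma b)
  end.

Definition cpair : Type := (formula * formula)%type.

Notation "phi ⊴ psi" := ((phi%cl, psi%cl) : cpair) (at level 70).

(* The letters p, q, r in which the axioms are written; the rules of [CL],
   in contrast, range over arbitrary formulas. *)
Definition p : formula := Var 0.
Definition q : formula := Var 1.
Definition r : formula := Var 2.

Inductive CL (Gamma : set cpair) : set cpair :=
| CL_ax c : Gamma c -> CL Gamma c
| CL_subst sigma a b :
    CL Gamma (a ⊴ b) -> CL Gamma (usubst sigma a ⊴ usubst sigma b)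
| CL_top : CL Gamma (p ⊴ ⊤)
| CL_bot : CL Gamma (⊥ ⊴ p)
| CL_refl : CL Gamma (p ⊴ p)
| CL_andl : CL Gamma (p ∧ q ⊴ p)
| CL_andr : CL Gamma (p ∧ q ⊴ q)
| CL_orl : CL Gamma (p ⊴ p ∨ q)
| CL_orr : CL Gamma (q ⊴ p ∨ q)
| CL_imp_top : CL Gamma (⊤ ⊴ p ⇒ ⊤)
| CL_imp_and : CL Gamma (p ⇒ (q ∧ r) ⊴ (p ⇒ q) ∧ (p ⇒ r))
| CL_and_imp : CL Gamma ((p ⇒ q) ∧ (p ⇒ r) ⊴ p ⇒ (q ∧ r))
| CL_trans a b c : CL Gamma (a ⊴ b) -> CL Gamma (b ⊴ c) -> CL Gamma (a ⊴ c)
| CL_and_intro a b c :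
    CL Gamma (c ⊴ a) -> CL Gamma (c ⊴ b) -> CL Gamma (c ⊴ a ∧ b)
| CL_or_elim a b c :
    CL Gamma (a ⊴ c) -> CL Gamma (b ⊴ c) -> CL Gamma (a ∨ b ⊴ c)
| CL_congl a b c :
    CL Gamma (a ⊴ b) -> CL Gamma (b ⊴ a) -> CL Gamma (a ⇒ c ⊴ b ⇒ c)
| CL_congr a b c :
    CL Gamma (a ⊴ b) -> CL Gamma (b ⊴ a) -> CL Gamma (c ⇒ a ⊴ c ⇒ b).

Definition int_axioms : set cpair :=
  [set c | [\/ c = (⊤ ⊴ p ⇒ p), c = (p ∧ (p ⇒ q) ⊴ q) | c = (p ⊴ q ⇒ p)]].

(* [tMeetSemilatticeType] asks for a boolean order and a choice operator; with
   the axioms of [boolp] every meet-semilattice with top carries them. *)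
Section Frames.
Context (d : Order.disp_t) (X : tMeetSemilatticeType d).

Definition upset (x : X) : set X := [set y | (x <= y)%O].

Record sfilter : Type := SFilter {
  members :> set X;
  sfilter_top : members \top%O;
  sfilter_meet : forall x y,
    members x -> members y -> members (x `&` y)%O;
  sfilter_up : forall x y, (x <= y)%O -> members x -> members y }.

Record selection_frame : Type := SelectionFrame {
  sel :> X -> sfilter -> sfilter;
  sel_top : forall a, sel \top%O a = [set \top%O] :> set X;
  sel_anti : forall x y a, (x <= y)%O -> sel y a `<=` sel x a;
  sel_meet : forall x y a z, members (sel (x `&` y)%O a) z ->
    exists u v, [/\ members (sel x a) u, members (sel y a) v & (u `&` v <= z)%O] }.

#[local] Obligation Tactic := idtac.

Program Definition sf_top : sfilter := @SFilter setT _ _ _.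
Next Obligation. by []. Qed.
Next Obligation. by []. Qed.
Next Obligation. by []. Qed.

Program Definition sf_bot : sfilter := @SFilter [set \top%O] _ _ _.
Next Obligation. by []. Qed.
Next Obligation. by move=> x y -> ->; rewrite /= meetxx. Qed.
Next Obligation. by move=> x y xy xT; apply/le_anti; rewrite lex1 -{1}xT. Qed.

Program Definition sf_and (a b : sfilter) : sfilter := @SFilter (a `&` b) _ _ _.
Next Obligation. by move=> a b; split; exact: sfilter_top. Qed.
Next Obligation.
by move=> a b x y [ax bx] [ay b_y]; split; exact: sfilter_meet.
Qed.
Next Obligation.
by move=> a b x y xy [ax bx]; split; exact: (sfilter_up xy).
Qed.

Program Definition sf_or (a b : sfilter) : sfilter :=
  @SFilter [set x | exists y z, [/\ members a y, members b z & (y `&` z <= x)%O]] _ _ _.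
Next Obligation.
move=> a b; exists \top%O, \top%O.
by split; [exact: sfilter_top|exact: sfilter_top|exact: lex1].
Qed.
Next Obligation.
move=> a b x x' [y [z [ay bz yzx]]] [y' [z' [ay' bz' yzx']]].
exists (y `&` y')%O, (z `&` z')%O; split; [exact: sfilter_meet..|].
by rewrite meetACA; exact: leI2.
Qed.
Next Obligation.
move=> a b x x' xx' [y [z [ay bz yzx]]]; exists y, z; split => //.
exact: le_trans xx'.
Qed.

Program Definition sf_imp (s : selection_frame) (a b : sfilter) : sfilter :=
  @SFilter [set x | s x a `<=` b] _ _ _.
Next Obligation.
by move=> s a b; rewrite /= sel_top => _ ->; exact: sfilter_top.
Qed.
Next Obligation.
move=> s a b x y /= xab yab z /sel_meet[u [v [xu yv uvz]]].
by apply: (sfilter_up uvz); apply: sfilter_meet; [exact: xab|exact: yab].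
Qed.
Next Obligation.
by move=> s a b x y xy /= xab; apply: subset_trans xab; exact: sel_anti.
Qed.

(* Truth sets are filters, as required for applying the selection function to
   them, so the interpretation is filter-valued from the outset. *)
Fixpoint truth (s : selection_frame) (V : nat -> sfilter) (phi : formula)
    : sfilter :=
  match phi with
  | Var n => V n
  | Top => sf_top
  | Bot => sf_bot
  | And a b => sf_and (truth s V a) (truth s V b)
  | Or a b => sf_or (truth s V a) (truth s V b)
  | Imp a b => sf_imp s (truth s V a) (truth s V b)
  end.

Definition validates (s : selection_frame) (c : cpair) : Prop :=
  forall V : nat -> sfilter, truth s V c.1 `<=` truth s V c.2.

End Frames.

(* Main.v *)
Require Import Defs.
From HB Require Import structures.
From mathcomp Require Import all_boot all_order.
From mathcomp Require Import boolp classical_sets.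

(** The three axioms turn [⇒] into the residual of [∧], so the logic is that of
    Heyting algebras.  Soundness is an induction on derivations.  For
    completeness, the theories (filters of the Lindenbaum algebra) ordered by
    inclusion form a meet-semilattice whose top is the inconsistent theory.
    Since the Lindenbaum algebra is distributive, [x ∩ y ⊆ z] implies
    [(x + z) ∩ (y + z) ⊆ z], where [+] is the join of theories; as [x + z] and
    [y + z] belong to every filter containing [z], this makes [a ∩ ↑x] a
    selection function.  Under the canonical valuation a theory forces exactly
    its members. *)

Set Implicit Arguments.
Unset Strict Implicit.
Unset Printing Implicit Defensive.

Import Order.Theory.

Local Open Scope classical_set_scope.

(** The axioms are stated for the letters [p], [q], [r] only; this substitution turns them into
    schemes. *)
Definition subst3 (a b c : formula) (n : nat) : formula :=
  match n with 0 => a | 1 => b | _ => c end.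

(** * Rules derivable over any set of axioms *)

Section DerivedRules.
Context (Gamma : set cpair).
Implicit Types a b c e : formula.
Local Notation "a ⊢ b" := (CL Gamma (a ⊴ b)) (at level 70).

Lemma CLxx a : a ⊢ a.
Proof. exact: (CL_subst (subst3 a a a) (CL_refl Gamma)). Qed.

Lemma CLx1 a : a ⊢ ⊤%cl.
Proof. exact: (CL_subst (subst3 a a a) (CL_top Gamma)). Qed.

Lemma CL0x a : ⊥%cl ⊢ a.
Proof. exact: (CL_subst (subst3 a a a) (CL_bot Gamma)). Qed.

Lemma CL_andL a b : (a ∧ b)%cl ⊢ a.
Proof. exact: (CL_subst (subst3 a b b) (CL_andl Gamma)). Qed.

Lemma CL_andR a b : (a ∧ b)%cl ⊢ b.
Proof. exact: (CL_subst (subst3 a b b) (CL_andr Gamma)). Qed.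

Lemma CL_orL a b : a ⊢ (a ∨ b)%cl.
Proof. exact: (CL_subst (subst3 a b b) (CL_orl Gamma)). Qed.

Lemma CL_orR a b : b ⊢ (a ∨ b)%cl.
Proof. exact: (CL_subst (subst3 a b b) (CL_orr Gamma)). Qed.

Lemma CL_impI a b c : ((c ⇒ a) ∧ (c ⇒ b))%cl ⊢ (c ⇒ (a ∧ b))%cl.
Proof. exact: (CL_subst (subst3 c a b) (CL_and_imp Gamma)). Qed.

Lemma CL_and2 a a' b b' : a ⊢ a' -> b ⊢ b' -> (a ∧ b)%cl ⊢ (a' ∧ b')%cl.
Proof.
move=> aa' bb'; apply: CL_and_intro.
- by apply: CL_trans aa'; exact: CL_andL.
- by apply: CL_trans bb'; exact: CL_andR.
Qed.

Lemma CL_andC a b : (a ∧ b)%cl ⊢ (b ∧ a)%cl.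
Proof. by apply: CL_and_intro; [exact: CL_andR|exact: CL_andL]. Qed.

(** Only congruence is primitive, but [a ⊢ b] makes [a] equivalent to [a ∧ b], and [c ⇒ (a ∧ b)]
    splits into a conjunction. *)
Lemma CL_imp_monor a b c : a ⊢ b -> (c ⇒ a)%cl ⊢ (c ⇒ b)%cl.
Proof.
move=> ab; have aab : a ⊢ (a ∧ b)%cl by apply: CL_and_intro; [exact: CLxx|].
apply: CL_trans (CL_congr c aab (CL_andL a b)) _.
have /CL_trans := CL_subst (subst3 c a b) (CL_imp_and Gamma).
by apply; exact: CL_andR.
Qed.

End DerivedRules.

(** * Implication as the residual of conjunction *)

Local Notation "a ⊢ b" := (CL int_axioms (a ⊴ b)) (at level 70).

(** The axioms give [c ⊢ a ⇒ c] and [⊤ ⊢ a ⇒ a], hence [c ⊢ a ⇒ (c ∧ a)]; then the consequent is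
    weakened to [b]. *)
Lemma int_curry a b c : (c ∧ a)%cl ⊢ b -> c ⊢ (a ⇒ b)%cl.
Proof.
move=> cab; have weak : CL int_axioms (p ⊴ q ⇒ p) by apply: CL_ax; exact: Or33.
have refl : CL int_axioms (⊤ ⊴ p ⇒ p) by apply: CL_ax; exact: Or31.
have c_ac : c ⊢ (a ⇒ c)%cl := CL_subst (subst3 c a a) weak.
have aa : ⊤%cl ⊢ (a ⇒ a)%cl := CL_subst (subst3 a a a) refl.
apply: CL_trans (CL_imp_monor a cab).
apply: CL_trans (CL_impI int_axioms c a a).
by apply: CL_and_intro => //; exact: CL_trans (CLx1 _ c) aa.
Qed.

Lemma int_mp a b : (a ∧ (a ⇒ b))%cl ⊢ b.
Proof.
have mp : CL int_axioms (p ∧ (p ⇒ q) ⊴ q) by apply: CL_ax; exact: Or32.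
exact: (CL_subst (subst3 a b b) mp).
Qed.

Lemma int_uncurry a b c : c ⊢ (a ⇒ b)%cl -> (c ∧ a)%cl ⊢ b.
Proof.
move=> cab; apply: CL_trans (int_mp a b).
by apply: CL_trans (CL_andC _ c a) _; apply: CL_and2 cab; exact: CLxx.
Qed.

(** * Soundness *)

Section Soundness.
Context (d : Order.disp_t) (X : tMeetSemilatticeType d).

Lemma sfilter_ext (a b : sfilter X) : a = b :> set X -> a = b.
Proof.
case: a b => [A aT aI aU] [B bT bI bU] /= AB.
by move: bT bI bU; rewrite -AB => bT bI bU; congr SFilter; exact: Prop_irrelevance.
Qed.

Lemma truth_subst (s : selection_frame X) (V : nat -> sfilter X) sigma a :
  truth s V (usubst sigma a) = truth s (fun n => truth s V (sigma n)) a.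
Proof. by elim: a => //= a -> b ->. Qed.

Lemma CL_sound (Gamma : set cpair) (s : selection_frame X) :
  (forall c, Gamma c -> validates s c) ->
  forall c, CL Gamma c -> validates s c.
Proof.
move=> sG c; elim=> {c}.
- by move=> c /sG.
- by move=> sigma a b _ IH V; rewrite /= !truth_subst; exact: IH.
- by move=> V x.
- by move=> V x /= ->; exact: sfilter_top.
- by move=> V x.
- by move=> V x [].
- by move=> V x [].
- move=> V x px; exists x, \top%O.
  by split=> //; [exact: sfilter_top|exact: leIl].
- move=> V x qx; exists \top%O, x.
  by split=> //; [exact: sfilter_top|exact: leIr].
- by move=> V x.
- by move=> V x /= h; split=> y /h[].
- by move=> V x /= [h1 h2] y sy; split; [exact: h1|exact: h2].
- by move=> a b c _ ab _ bc V x /ab /bc.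
- by move=> a b c _ ca _ cb V x cx; split; [exact: ca|exact: cb].
- move=> a b c _ ac _ bc V x [y [z [ay bz yzx]]].
  by apply: (sfilter_up yzx); apply: sfilter_meet; [exact: ac|exact: bc].
- move=> a b c _ ab _ ba V x /=.
  (* Selection is not assumed monotone in its filter argument, so the two inclusions must be
     combined into an equality of filters. *)
  suff -> : truth s V a = truth s V b by [].
  by apply: sfilter_ext; apply/seteqP; split; [exact: ab|exact: ba].
- by move=> a b c _ ab _ _ V x /= h y /h /ab.
Qed.

Lemma int_axioms_valid (s : selection_frame X) :
  (forall (x : X) (a : sfilter X), s x a = a `&` upset x :> set X) ->
  forall c, int_axioms c -> validates s c.
Proof.
move=> sE c [] -> V x /=.
- by move=> _; rewrite sE => y [].
(* Here [x] itself lies in the selected set, the intersection of the truth set of [p] with the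
   up-set of [x]. *)
- by move=> [px]; rewrite sE; apply; split=> //; exact: lexx.
- by move=> px; rewrite sE => y [_ xy]; exact: (sfilter_up xy).
Qed.

End Soundness.

(** * The meet-semilattice of theories *)

Record theory (Gamma : set cpair) : Type := Theory {
  thms :> set formula;
  thms_top : thms ⊤%cl;
  thms_and : forall a b, thms a -> thms b -> thms (a ∧ b)%cl;
  thms_up : forall a b, CL Gamma (a ⊴ b) -> thms a -> thms b }.

Fact theory_display : Order.disp_t. Proof. exact: (Order.Disp tt tt). Qed.

Section TheorySemilattice.
Context (Gamma : set cpair).
Implicit Types x y z : theory Gamma.

Lemma theory_ext x y : x = y :> set formula -> x = y.
Proof.
case: x y => [A aT aI aU] [B bT bI bU] /= AB.
by move: bT bI bU; rewrite -AB => bT bI bU; congr Theory; exact: Prop_irrelevance.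
Qed.

Definition th_le x y : bool := `[< thms x `<=` y >].

Lemma th_le_refl : reflexive th_le.
Proof. by move=> x; apply/asboolP. Qed.

Lemma th_le_anti : antisymmetric th_le.
Proof.
by move=> x y /andP[/asboolP xy /asboolP yx]; apply: theory_ext; apply/seteqP.
Qed.

Lemma th_le_trans : transitive th_le.
Proof. by move=> y x z /asboolP xy /asboolP yz; apply/asboolP => a /xy /yz. Qed.

Definition th_meet x y : theory Gamma.
Proof.
exists (thms x `&` thms y).
- by split; exact: thms_top.
- by move=> a b [xa ya] [xb yb]; split; exact: thms_and.
- by move=> a b ab [xa ya]; split; exact: thms_up ab _.
Defined.

Definition th_top : theory Gamma.
Proof. by exists setT. Defined.

Lemma th_leI x y z : th_le x (th_meet y z) = th_le x y && th_le x z.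
Proof.
apply/asboolP/andP => [h|[/asboolP xy /asboolP xz] a xa].
- by split; apply/asboolP => a /h[].
- by split; [exact: xy|exact: xz].
Qed.

Lemma th_lex1 x : th_le x th_top.
Proof. exact/asboolP. Qed.

HB.instance Definition _ := gen_eqMixin (theory Gamma).
HB.instance Definition _ := gen_choiceMixin (theory Gamma).
HB.instance Definition _ := Order.Le_isPOrder.Build theory_display
  (theory Gamma) th_le_refl th_le_anti th_le_trans.
HB.instance Definition _ := Order.POrder_isMeetSemilattice.Build theory_display
  (theory Gamma) th_leI.
HB.instance Definition _ := Order.hasTop.Build theory_display
  (theory Gamma) th_lex1.

Lemma theory_leP x y : reflect (thms x `<=` y) (x <= y)%O.
Proof. exact: asboolP. Qed.

Definition th_gen (a : formula) : theory Gamma.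
Proof.
exists [set b | CL Gamma (a ⊴ b)].
- exact: CLx1.
- by move=> b c; exact: CL_and_intro.
- by move=> b c bc ab; exact: CL_trans bc.
Defined.

(** One formula from each side suffices because theories are closed under [∧]; this is the least
    theory containing both. *)
Definition th_join x y : theory Gamma.
Proof.
exists [set c | exists a b, [/\ thms x a, thms y b & CL Gamma (a ∧ b ⊴ c)]].
- by exists ⊤%cl, ⊤%cl; split; [exact: thms_top..|exact: CLx1].
- move=> c c' [a [b [xa yb abc]]] [a' [b' [xa' yb' abc']]].
  exists (a ∧ a')%cl, (b ∧ b')%cl; split; [exact: thms_and..|].
  apply: CL_and_intro.
  + by apply: CL_trans abc; apply: CL_and2; exact: CL_andL.
  + by apply: CL_trans abc'; apply: CL_and2; exact: CL_andR.
- move=> c e ce [a [b [xa yb abc]]]; exists a, b; split=> //.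
  exact: CL_trans ce.
Defined.

Lemma th_joinl x y : (x <= th_join x y)%O.
Proof.
apply/theory_leP => a xa; exists a, ⊤%cl.
by split=> //; [exact: thms_top|exact: CL_andL].
Qed.

Lemma th_joinr x y : (y <= th_join x y)%O.
Proof.
apply/theory_leP => b yb; exists ⊤%cl, b.
by split=> //; [exact: thms_top|exact: CL_andR].
Qed.

End TheorySemilattice.

(** * The canonical frame *)

Local Notation int_theory := (theory int_axioms).

(** If [a ∧ e ⊢ c] and [a' ∧ e' ⊢ c], then [a ∨ a'] lies in both [x] and [y], hence in [z], and
    residuation allows a case split in [(a ∨ a') ∧ (e ∧ e') ⊢ c]. *)
Lemma th_join_distr (x y z : int_theory) :
  (x `&` y <= z -> th_join x z `&` th_join y z <= z)%O.
Proof.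
move=> /theory_leP xyz; apply/theory_leP => c.
move=> [[a [e [xa ze aec]]] [a' [e' [ya' ze' aec']]]].
have za : thms z (a ∨ a')%cl.
  by apply: xyz; split; [apply: thms_up xa; exact: CL_orL|
                         apply: thms_up ya'; exact: CL_orR].
apply: thms_up (thms_and za (thms_and ze ze')).
apply: int_uncurry; apply: CL_or_elim; apply: int_curry.
- by apply: CL_trans aec; apply: CL_and2; [exact: CLxx|exact: CL_andL].
- by apply: CL_trans aec'; apply: CL_and2; [exact: CLxx|exact: CL_andR].
Qed.

Definition sf_up (d : Order.disp_t) (X : tMeetSemilatticeType d) (x : X) :
  sfilter X.
Proof.
exists (upset x).
- exact: lex1.
- by move=> y z xy xz; rewrite /upset /= lexI; apply/andP.
- by move=> y z yz xy; exact: le_trans yz.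
Defined.

Definition canonical_frame : selection_frame int_theory.
Proof.
exists (fun x a => sf_and a (sf_up x)).
- move=> a; apply/seteqP; split=> [x [_ /= Tx]|x ->].
  + by apply: le_anti; rewrite lex1.
  + by split; [exact: sfilter_top|exact: lexx].
- by move=> x y a xy z [az yz]; split=> //; exact: le_trans yz.
- move=> x y a z [az xyz]; exists (th_join x z), (th_join y z); split.
  + by split; [apply: sfilter_up az; exact: th_joinr|exact: th_joinl].
  + by split; [apply: sfilter_up az; exact: th_joinr|exact: th_joinl].
  + exact: th_join_distr.
Defined.

(** * Truth lemma and completeness *)

Definition sf_thm (a : formula) : sfilter int_theory.
Proof.
exists [set x | thms x a].
- by [].
- by [].
- by move=> x y /theory_leP xy /xy.
Defined.

Lemma canonical_truth a :
  truth canonical_frame (fun n => sf_thm (Var n)) a = sf_thm a.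
Proof.
elim: a => [n|||a /= -> b ->|a /= -> b ->|a /= -> b ->] //;
  apply: sfilter_ext; apply/seteqP; split=> x.
- by move=> _; exact: thms_top.
- by [].
- by move=> ->.
- move=> x0; apply: le_anti; rewrite lex1; apply/theory_leP => b _.
  by apply: thms_up x0; exact: CL0x.
- by move=> [xa xb]; exact: thms_and.
- move=> xab; split; apply: thms_up xab; [exact: CL_andL|exact: CL_andR].
- move=> [y [z [ya zb /theory_leP yzx]]]; apply: yzx; split.
  + by apply: thms_up ya; exact: CL_orL.
  + by apply: thms_up zb; exact: CL_orR.
(* The principal theories of [a] and [b] meet in that of [a ∨ b], which [x] contains. *)
- move=> xab; exists (th_gen int_axioms a), (th_gen int_axioms b).
  split; [exact: CLxx..|].
  by apply/theory_leP => c [ac bc]; apply: thms_up xab; exact: CL_or_elim.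
(* Test the least theory that extends [x] and contains [a]: that it contains [b] means that some [c]
   in [x] has [c ∧ a ⊢ b]. *)
- move=> /(_ (th_join x (th_gen int_axioms a)))[].
    split; last exact: th_joinl.
    by have /theory_leP := th_joinr x (th_gen int_axioms a); apply; exact: CLxx.
  move=> c [e [xc ae ceb]]; apply: thms_up xc; apply: int_curry.
  by apply: CL_trans ceb; apply: CL_and2 ae; exact: CLxx.
- move=> xab y [ya /theory_leP xy].
  exact: thms_up (int_mp a b) (thms_and ya (xy _ xab)).
Qed.

Theorem theorem5p20 (phi psi : formula) :
  CL int_axioms (phi ⊴ psi) <->
  (forall (d : Order.disp_t) (X : tMeetSemilatticeType d)
          (s : selection_frame X),
     (forall (x : X) (a : sfilter X), s x a = a `&` upset x :> set X) ->
     validates s (phi ⊴ psi)).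
Proof.
split=> [phi_psi d X s /int_axioms_valid sI|valid].
  exact: CL_sound sI _ phi_psi.
(* The frame condition holds by definition; the principal theory of [phi] forces [phi], hence [psi],
   which says that [phi ⊢ psi]. *)
have := valid _ _ canonical_frame (fun _ _ => erefl) (fun n => sf_thm (Var n)).
rewrite !canonical_truth => /(_ (th_gen int_axioms phi)); apply.
exact: CLxx.
Qed.
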